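(* For all CCS$^!$ expressions $R,R'$ and $\alpha\in Act$: if $R\xrightarrow{\alpha}R'$ in the LTS of CCS$^!$ then $dec(R)\,[\alpha\rangle\, dec(R')$ in the unmarked Petri net of CCS$^!$. Moreover, if $dec(R)\,[\alpha\rangle\, M$ for a marking $M$, then there is a CCS$^!$ expression $R'$ with $R\xrightarrow{\alpha}R'$ and $dec(R')=M$.
   Context: CCS$^!$: names $\mathcal A$, agent identifiers $\mathcal K$, output actions $O$; handshake actions $H=\mathcal A\uplus\{\bar a\mid a\in\mathcal A\}$ with $\bar{\bar a}=a$; $Act=H\uplus O\uplus\{\tau\}$. A relabelling is $f:H\to H$ with $f(\bar a)=\overline{f(a)}$, extended by $f(\alpha)=\alpha$ on $O\cup\{\tau\}$. Expressions: agent identifiers $A$ (each with a defining equation $A\stackrel{def}{=}P$), $\alpha.P$, $\sum_{i\in I}P_i$ (any index set), $P|Q$, $P\backslash a$ ($a\in H$), $P[f]$. LTS rules: $\alpha.P\xrightarrow{\alpha}P$; $P_j\xrightarrow{\alpha}P'$, $j\in I$ gives $\sum_{i\in I}P_i\xrightarrow{\alpha}P'$; $P\xrightarrow{\alpha}P'$ gives $P|Q\xrightarrow{\alpha}P'|Q$; $Q\xrightarrow{\alpha}Q'$ gives $P|Q\xrightarrow{\alpha}P|Q'$; $P\xrightarrow{a}P'$, $Q\xrightarrow{\bar a}Q'$ gives $P|Q\xrightarrow{\tau}P'|Q'$; $P\xrightarrow{\alpha}P'$, $a\ne\alpha\ne\bar a$ gives $P\backslash a\xrightarrow{\alpha}P'\backslash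 a$; $P\xrightarrow{\alpha}P'$ gives $P[f]\xrightarrow{f(\alpha)}P'[f]$; $P\xrightarrow{\alpha}P'$ and $A\stackrel{def}{=}P$ give $A\xrightarrow{\alpha}P'$. Petri net semantics: the set of places (grapes) is the smallest set containing $A$, $\alpha.P$, $\sum_{i\in I}P_i$ (for CCS$^!$ expressions $P,P_i$), and $\mu\backslash a$, $\mu|$, $|\mu$, $\mu[f]$ for grapes $\mu$. The map $dec$ from expressions to sets of grapes: $dec(\alpha.P)=\{\alpha.P\}$, $dec(A)=\{A\}$, $dec(\sum_{i\in I}P_i)=\{\sum_{i\in I}P_i\}$, $dec(P|Q)=dec(P)|\cup|dec(Q)$, $dec(P\backslash a)=dec(P)\backslash a$, $dec(P[f])=dec(P)[f]$, where $H|$, $|H$, $H\backslash a$, $H[f]$ apply the constructor elementwise to (multi)sets. Transitions of the unmarked net are triples $H\xrightarrow{\alpha}J$ (meaning a transition $u$ with preset ${}^\bullet u=H$, postset $u^\bullet=J$, label $\alpha$) with $H,J$ multisets of grapes, derived by: $\{\alpha.P\}\xrightarrow{\alpha}dec(P)$; if $(dec(P_j)-K)\xrightarrow{\alpha}J$ with $j\in I$, $K\le dec(P_j)$ then $\{\sum_{i\in I}P_i\}\xrightarrow{\alpha}J+K$; if $H\xrightarrow{\alpha}J$ then $H|\xrightarrow{\alpha}J|$ and $|H\xrightarrow{\alpha}|J$; if $H\xrightarrow{a}J$ and $K\xrightarrow{\bar a}L$ then $H|+|K\xrightarrow{\tau}J|+|L$; if $H\xrightarrow{\alpha}J$ and $a\ne\alpha\ne\bar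 a$ then $H\backslash a\xrightarrow{\alpha}J\backslash a$; if $H\xrightarrow{\alpha}J$ then $H[f]\xrightarrow{f(\alpha)}J[f]$; if $(dec(P)-K)\xrightarrow{\alpha}J$, $A\stackrel{def}{=}P$, $K\le dec(P)$ then $\{A\}\xrightarrow{\alpha}J+K$. For markings (multisets of grapes) $M,M'$, $M[\alpha\rangle M'$ means there is a transition $H\xrightarrow{\alpha}J$ and a multiset $K$ with $M=H+K$ and $M'=J+K$. *)

(* Defs.v *)
From HB Require Import structures.
From mathcomp Require Import all_boot.
From mathcomp Require Import boolp classical_sets fsbigop.

Set Implicit Arguments.
Unset Strict Implicit.
Unset Printing Implicit Defensive.

Local Open Scope classical_set_scope.

(** Throughout, [N] is the type of names, [K] that of agent identifiers and [O]
    that of output actions. *)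

Inductive handshake (N : Type) : Type :=
| Name of N
| Coname of N.

Definition bar (N : Type) (h : handshake N) : handshake N :=
  match h with Name a => Coname a | Coname a => Name a end.

Inductive action (N O : Type) : Type :=
| Hand of handshake N
| Out of O
| Tau.

Arguments Hand {N O} _.
Arguments Out {N O} _.
Arguments Tau {N O}.

Record relabelling (N : Type) := Relabelling {
  relab_fun :> handshake N -> handshake N;
  relab_bar : forall a, relab_fun (bar a) = bar (relab_fun a) }.

Definition relab_act (N O : Type) (f : relabelling N) (al : action N O) :
    action N O :=
  match al with Hand h => Hand (f h) | Out o => Out o | Tau => Tau end.

Inductive ccs (N K O : Type) : Type :=
| Ident of K
| Prefix of action N O & ccs N K O
| Sum (I : Type) of (I -> ccs N K O)
| Par of ccs N K O & ccs N K O
| Restr of ccs N K O & handshake N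
| Relab of ccs N K O & relabelling N.

Arguments Ident {N K O} _.
Arguments Prefix {N K O} _ _.
Arguments Sum {N K O I} _.
Arguments Par {N K O} _ _.
Arguments Restr {N K O} _ _.
Arguments Relab {N K O} _ _.

(** [def A] is the body of the defining equation of the identifier [A]. *)
Inductive lts (N K O : Type) (def : K -> ccs N K O) :
    ccs N K O -> action N O -> ccs N K O -> Prop :=
| LtsPrefix al P : lts def (Prefix al P) al P
| LtsSum (I : Type) (P : I -> ccs N K O) j al P' :
    lts def (P j) al P' -> lts def (Sum P) al P'
| LtsParL P Q al P' :
    lts def P al P' -> lts def (Par P Q) al (Par P' Q)
| LtsParR P Q al Q' :
    lts def Q al Q' -> lts def (Par P Q) al (Par P Q')
| LtsComm P Q a P' Q' :
    lts def P (Hand a) P' -> lts def Q (Hand (bar a)) Q' ->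
    lts def (Par P Q) Tau (Par P' Q')
| LtsRestr P a al P' :
    lts def P al P' -> Hand a <> al -> al <> Hand (bar a) ->
    lts def (Restr P a) al (Restr P' a)
| LtsRelab P f al P' :
    lts def P al P' -> lts def (Relab P f) (relab_act f al) (Relab P' f)
| LtsIdent A al P' :
    lts def (def A) al P' -> lts def (Ident A) al P'.

Definition multiset (T : Type) := T -> nat.

Definition mset_of (T : Type) (A : set T) : multiset T :=
  fun x => x \in A.

Definition madd (T : Type) (H J : multiset T) : multiset T :=
  fun x => H x + J x.

Definition msub (T : Type) (H J : multiset T) : multiset T :=
  fun x => H x - J x.

Definition mle (T : Type) (H J : multiset T) : Prop :=
  forall x, H x <= J x.

(** The sum over the fibre is [0] by convention when infinitely many of its
    terms are nonzero; [mimage] is only used with injective [c], whose fibres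
    have at most one element. *)
Definition mimage (T : choiceType) (U : Type) (c : T -> U) (H : multiset T) :
    multiset U :=
  fun y => \big[addn/0]_(x \in [set x | c x = y]) H x.

(** [GParL mu], [GParR mu], [GRestr mu a], [GRelab mu f] stand for the grapes
    written [mu|], [|mu], [mu\a] and [mu[f]]. *)
Inductive grape (N K O : Type) : Type :=
| GIdent of K
| GPrefix of action N O & ccs N K O
| GSum (I : Type) of (I -> ccs N K O)
| GRestr of grape N K O & handshake N
| GParL of grape N K O
| GParR of grape N K O
| GRelab of grape N K O & relabelling N.

Arguments GIdent {N K O} _.
Arguments GPrefix {N K O} _ _.
Arguments GSum {N K O I} _.
Arguments GRestr {N K O} _ _.
Arguments GParL {N K O} _.
Arguments GParR {N K O} _.
Arguments GRelab {N K O} _ _.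

HB.instance Definition _ (N K O : Type) := gen_eqMixin (grape N K O).
HB.instance Definition _ (N K O : Type) := gen_choiceMixin (grape N K O).

Fixpoint dec_set (N K O : Type) (P : ccs N K O) : set (grape N K O) :=
  match P with
  | Ident A => [set GIdent A]
  | Prefix al P => [set GPrefix al P]
  | Sum _ P => [set GSum P]
  | Par P Q => (@GParL N K O @` dec_set P) `|` (@GParR N K O @` dec_set Q)
  | Restr P a => (fun mu => GRestr mu a) @` dec_set P
  | Relab P f => (fun mu => GRelab mu f) @` dec_set P
  end.

Definition dec (N K O : Type) (P : ccs N K O) : multiset (grape N K O) :=
  mset_of (dec_set P).

Definition mparL (N K O : Type) (H : multiset (grape N K O)) :
  multiset (grape N K O) := mimage (@GParL N K O) H.

Definition mparR (N K O : Type) (H : multiset (grape N K O)) :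
  multiset (grape N K O) := mimage (@GParR N K O) H.

Definition mrestr (N K O : Type) (a : handshake N)
    (H : multiset (grape N K O)) : multiset (grape N K O) :=
  mimage (fun mu : grape N K O => GRestr mu a) H.

Definition mrelab (N K O : Type) (f : relabelling N)
    (H : multiset (grape N K O)) : multiset (grape N K O) :=
  mimage (fun mu : grape N K O => GRelab mu f) H.

(** [trans def H al J]: the net has a transition with preset [H], label [al]
    and postset [J]. *)
Inductive trans (N K O : Type) (def : K -> ccs N K O) :
    multiset (grape N K O) -> action N O -> multiset (grape N K O) -> Prop :=
| TrPrefix al P :
    trans def (mset_of [set GPrefix al P]) al (dec P)
| TrSum (I : Type) (P : I -> ccs N K O) j L al J :
    mle L (dec (P j)) -> trans def (msub (dec (P j)) L) al J ->
    trans def (mset_of [set GSum P]) al (madd J L)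
| TrParL H al J :
    trans def H al J -> trans def (mparL H) al (mparL J)
| TrParR H al J :
    trans def H al J -> trans def (mparR H) al (mparR J)
| TrComm H a J L M :
    trans def H (Hand a) J -> trans def L (Hand (bar a)) M ->
    trans def (madd (mparL H) (mparR L)) Tau (madd (mparL J) (mparR M))
| TrRestr H al J a :
    trans def H al J -> Hand a <> al -> al <> Hand (bar a) ->
    trans def (mrestr a H) al (mrestr a J)
| TrRelab H al J f :
    trans def H al J -> trans def (mrelab f H) (relab_act f al) (mrelab f J)
| TrIdent A L al J :
    mle L (dec (def A)) -> trans def (msub (dec (def A)) L) al J ->
    trans def (mset_of [set GIdent A]) al (madd J L).

Definition fires (N K O : Type) (def : K -> ccs N K O)
    (M : multiset (grape N K O)) (al : action N O)
    (M' : multiset (grape N K O)) : Prop :=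
  exists H J L : multiset (grape N K O),
    [/\ trans def H al J, M = madd H L & M' = madd J L].

(* Main.v *)
(** Both halves rest on the fact that [dec] turns each static operator into the
    corresponding sum of images of multisets, and that a decomposition
    [dec R = H + L] can be pulled back along these images. The second half is an
    induction on the derivation of the transition, for all expressions [R] whose
    decomposition contains its preset: as presets are nonempty, the shape of a
    single grape of the preset determines the head operator of [R]. *)

From mathcomp Require Import all_boot.
From mathcomp Require Import boolp classical_sets fsbigop.
Require Import Defs.

Set Implicit Arguments.
Unset Strict Implicit.
Unset Printing Implicit Defensive.

Local Open Scope classical_set_scope.

(** * Pointwise arithmetic of multisets *)

Definition mzero (T : Type) : multiset T := fun=> 0.

Section Multisets.
Variable T : Type.
Implicit Types H J L : multiset T.

Lemma maddC H J : madd H J = madd J H.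
Proof. by apply/funext => x; rewrite /madd addnC. Qed.

Lemma maddA H J L : madd H (madd J L) = madd (madd H J) L.
Proof. by apply/funext => x; rewrite /madd addnA. Qed.

Lemma maddAC H J L : madd (madd H J) L = madd (madd H L) J.
Proof. by rewrite -!maddA (maddC J). Qed.

Lemma maddACA H J L M :
  madd (madd H J) (madd L M) = madd (madd H L) (madd J M).
Proof. by rewrite !maddA (maddAC H J). Qed.

Lemma madd0 H : madd H (@mzero T) = H.
Proof. by apply/funext => x; rewrite /madd addn0. Qed.

Lemma msubK H L : mle L H -> madd (msub H L) L = H.
Proof. by move=> leLH; apply/funext => x; apply: subnK. Qed.

Lemma maddK H L : msub (madd H L) L = H.
Proof. by apply/funext => x; rewrite /msub /madd addnK. Qed.

Lemma mle_addr H L : mle L (madd H L).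
Proof. by move=> x; rewrite leq_addl. Qed.

(** Addition of naturals cancels at each point. Used when a preset exhausts the decomposition, to
    see that nothing is left over. *)
Lemma madd_eql H L : H = madd H L -> L = @mzero T.
Proof.
move=> eHL; apply/funext => x; have := congr1 (fun F => F x) eHL.
by rewrite /madd -{1}[H x]addn0 => /addnI.
Qed.

Lemma mset_of1_self (x : T) : 0 < mset_of [set x] x.
Proof. by rewrite /mset_of mem_set. Qed.

Lemma mset_of_gt0 (A : set T) x : 0 < mset_of A x -> A x.
Proof. by rewrite /mset_of lt0b inE. Qed.

End Multisets.

(** * Images of multisets along injective maps *)

Section Images.
Variables (T : choiceType) (U : Type) (c : T -> U).
Hypothesis c_inj : injective c.
Implicit Types H J L D : multiset T.

(** By injectivity the fibre over [c x] is [[set x]], so the sum has a single term. *)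
Lemma mimage_inj H x : mimage c H (c x) = H x.
Proof.
rewrite /mimage; have -> : [set z | c z = c x] = [set x].
  by apply/seteqP; split=> [z /c_inj|z ->].
by rewrite fsbig_set1.
Qed.

Lemma mimage_out H y : (forall x, c x <> y) -> mimage c H y = 0.
Proof.
move=> cNy; rewrite /mimage; have -> : [set z | c z = y] = set0.
  by apply/seteqP; split=> [z /cNy|z].
by rewrite fsbig_set0.
Qed.

Lemma mimageD H J : mimage c (madd H J) = madd (mimage c H) (mimage c J).
Proof.
apply/funext => y; rewrite /madd; have [[x <-]|cNy] := pselect (exists x, c x = y).
  by rewrite !mimage_inj.
by rewrite !mimage_out // => x cxy; apply: cNy; exists x.
Qed.

Lemma mimage0 : mimage c (@mzero T) = @mzero U.
Proof.
apply/funext => y; have [[x <-]|cNy] := pselect (exists x, c x = y).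
  by rewrite mimage_inj.
by rewrite mimage_out // => x cxy; apply: cNy; exists x.
Qed.

(** Distinct elements of [A] have distinct images, so no multiplicity in the image exceeds one. *)
Lemma mset_of_image (A : set T) : mset_of (c @` A) = mimage c (mset_of A).
Proof.
apply/funext => y; have [[x <-]|cNy] := pselect (exists x, c x = y).
  rewrite mimage_inj /mset_of; congr nat_of_bool.
  by apply/idP/idP; rewrite !inE; [case=> z Az /c_inj <-|exists x].
rewrite mimage_out => [|x cxy]; last by apply: cNy; exists x.
rewrite /mset_of memNset // => -[x _ cxy].
by apply: cNy; exists x.
Qed.

Lemma mimage_eq_madd D H (L : multiset U) :
  mimage c D = madd (mimage c H) L ->
  exists2 L', D = madd H L' & L = mimage c L'.
Proof.
move=> eD; have eDy y := congr1 (fun F => F y) eD.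
(* The remainder is read off along [c]. Outside the range of [c] the equation says [0 = 0 + L y], so
   no part of [L] is lost. *)
exists (L \o c); apply/funext.
  by move=> x; have := eDy (c x); rewrite /madd !mimage_inj.
move=> y; have [[x <-]|cNy] := pselect (exists x, c x = y).
  by rewrite mimage_inj.
have out x : c x <> y by move=> cxy; apply: cNy; exists x.
by have := eDy y; rewrite /madd !mimage_out.
Qed.

End Images.

(** As the ranges of [c] and [d] are disjoint, the equation at [c x] only involves [D], [H] and [L],
    and at [d y] only [E], [G] and [L]; outside both ranges it forces [L] to vanish. *)
Lemma mimage2_eq_madd (T1 T2 : choiceType) (U : Type) (c : T1 -> U)
    (d : T2 -> U) (D H : multiset T1) (E G : multiset T2) (L : multiset U) :
    injective c -> injective d -> (forall x y, c x <> d y) ->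
    madd (mimage c D) (mimage d E) =
      madd (madd (mimage c H) (mimage d G)) L ->
  exists L1 L2, [/\ D = madd H L1, E = madd G L2 &
                    L = madd (mimage c L1) (mimage d L2)].
Proof.
move=> c_inj d_inj cNd eL; have eLy y := congr1 (fun F => F y) eL.
have c_out x K : mimage d K (c x) = 0.
  by apply: mimage_out => y /esym; apply: cNd.
have d_out y K : mimage c K (d y) = 0 by apply: mimage_out => x; apply: cNd.
exists (L \o c), (L \o d); split; apply/funext.
- by move=> x; have := eLy (c x); rewrite /madd !mimage_inj // !c_out !addn0.
- by move=> y; have := eLy (d y); rewrite /madd !mimage_inj // !d_out.
move=> z; rewrite /madd.
have [[x <-]|cNz] := pselect (exists x, c x = z).
  by rewrite mimage_inj // c_out addn0.
have [[y <-]|dNz] := pselect (exists y, d y = z).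
  by rewrite mimage_inj // d_out.
have outc x : c x <> z by move=> cxz; apply: cNz; exists x.
have outd y : d y <> z by move=> dyz; apply: dNz; exists y.
by have := eLy z; rewrite /madd !(mimage_out _ outc) !(mimage_out _ outd).
Qed.

(** * Decompositions under the static operators *)

Section CCS.
Variables (N K O : Type) (def : K -> ccs N K O).
Implicit Types (P Q R : ccs N K O) (al : action N O) (mu : grape N K O).
Implicit Types H J L M : multiset (grape N K O).

Lemma GParL_inj : injective (@GParL N K O).
Proof. by move=> mu nu []. Qed.

Lemma GParR_inj : injective (@GParR N K O).
Proof. by move=> mu nu []. Qed.

Lemma GRestr_inj a : injective (fun mu => GRestr mu a).
Proof. by move=> mu nu []. Qed.

Lemma GRelab_inj f : injective (fun mu => GRelab mu f).
Proof. by move=> mu nu []. Qed.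

Lemma decPar P Q : dec (Par P Q) = madd (mparL (dec P)) (mparR (dec Q)).
Proof.
rewrite /mparL /mparR -(mset_of_image GParL_inj) -(mset_of_image GParR_inj).
apply/funext => mu; rewrite /dec /= /madd /mset_of in_setU.
(* The tags make the two images disjoint, so membership in the union is the sum of the two
   memberships. *)
case: (boolP (_ \in @GParL N K O @` _)) => //= /set_mem[x _ <-].
by rewrite memNset // => -[].
Qed.

Lemma decRestr P a : dec (Restr P a) = mrestr a (dec P).
Proof. exact: mset_of_image (@GRestr_inj a) _. Qed.

Lemma decRelab P f : dec (Relab P f) = mrelab f (dec P).
Proof. exact: mset_of_image (@GRelab_inj f) _. Qed.

(** * Recovering the head operator from one grape *)

Lemma dec_set_GIdent R A : dec_set R (GIdent A) -> R = Ident A.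
Proof. by case: R => [B [->]|?? []|?? []|?? [] []|?? []|?? []]. Qed.

Lemma dec_set_GPrefix R al P : dec_set R (GPrefix al P) -> R = Prefix al P.
Proof. by case: R => [? []|?? [-> ->]|?? []|?? [] []|?? []|?? []]. Qed.

(* Passing through a map from grapes to expressions avoids inverting an
   equality between dependent pairs over the index type. *)
Lemma dec_set_GSum R (I : Type) (P : I -> ccs N K O) :
  dec_set R (GSum P) -> R = Sum P.
Proof.
case: R => [? []|?? []|I' P' /= eP|?? [] []|?? []|?? []] //.
pose expr mu := if mu is GSum _ F then Sum F else Sum P.
exact: esym (congr1 expr eP).
Qed.

(** A grape of a static operator shows the operator and its parameter, but in general not the
    components, hence the existential form here and below. *)
Lemma dec_set_GParL R mu :
  dec_set R (GParL mu) -> exists P Q, R = Par P Q.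
Proof. by case: R => [? []|?? []|?? []|P Q _|?? []|?? []] //; exists P, Q. Qed.

Lemma dec_set_GParR R mu :
  dec_set R (GParR mu) -> exists P Q, R = Par P Q.
Proof. by case: R => [? []|?? []|?? []|P Q _|?? []|?? []] //; exists P, Q. Qed.

Lemma dec_set_GRestr R mu a :
  dec_set R (GRestr mu a) -> exists P, R = Restr P a.
Proof.
by case: R => [? []|?? []|?? []|?? [] []|P ? [? _ [_ ->]]|?? []] //; exists P.
Qed.

Lemma dec_set_GRelab R mu f :
  dec_set R (GRelab mu f) -> exists P, R = Relab P f.
Proof.
by case: R => [? []|?? []|?? []|?? [] []|?? []|P ? [? _ [_ ->]]] //; exists P.
Qed.

Lemma dec_madd_set R H L mu : dec R = madd H L -> 0 < H mu -> dec_set R mu.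
Proof. by move=> eR Hmu; apply: mset_of_gt0; rewrite -/(dec R) eR ltn_addr. Qed.

(** Prefixes, sums and identifiers have singleton presets, and the maps for static operators carry a
    grape of the premise to one of the conclusion. *)
Lemma trans_preset_gt0 H al J : trans def H al J -> exists mu, 0 < H mu.
Proof.
elim=> {H al J} [al P|I P j L al J _ _ _|H al J _ [mu Hmu]|H al J _ [mu Hmu]
  |H a J L M _ [mu Hmu] _ _|H al J a _ [mu Hmu] _ _|H al J f _ [mu Hmu]
  |A L al J _ _ _].
- by exists (GPrefix al P); apply: mset_of1_self.
- by exists (GSum P); apply: mset_of1_self.
- by exists (GParL mu); rewrite /mparL (mimage_inj GParL_inj).
- by exists (GParR mu); rewrite /mparR (mimage_inj GParR_inj).
- exists (GParL mu).
  by rewrite /madd ltn_addr // /mparL (mimage_inj GParL_inj).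
- by exists (GRestr mu a); rewrite /mrestr (mimage_inj (@GRestr_inj a)).
- by exists (GRelab mu f); rewrite /mrelab (mimage_inj (@GRelab_inj f)).
- by exists (GIdent A); apply: mset_of1_self.
Qed.

(** * Splitting and merging the marking of a parallel composition *)

Lemma mpar_eq_madd P Q H J L :
    dec (Par P Q) = madd (madd (mparL H) (mparR J)) L ->
  exists L1 L2, [/\ dec P = madd H L1, dec Q = madd J L2 &
                    L = madd (mparL L1) (mparR L2)].
Proof.
rewrite decPar; apply: mimage2_eq_madd => //.
- exact: GParL_inj.
- exact: GParR_inj.
Qed.

Lemma dec_ParD P Q H J L M : dec P = madd H L -> dec Q = madd J M ->
  dec (Par P Q) = madd (madd (mparL H) (mparR J)) (madd (mparL L) (mparR M)).
Proof.
move=> eP eQ; rewrite decPar eP eQ /mparL /mparR.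
by rewrite (mimageD GParL_inj) (mimageD GParR_inj) maddACA.
Qed.

(** With [mparR0], lets a step of one component be handled like a communication in which the idle
    component contributes an empty preset and postset. *)
Lemma mparL0 : mparL (@mzero (grape N K O)) = @mzero _.
Proof. exact: mimage0 GParL_inj. Qed.

Lemma mparR0 : mparR (@mzero (grape N K O)) = @mzero _.
Proof. exact: mimage0 GParR_inj. Qed.

Lemma madd0l H : madd (@mzero _) H = H.
Proof. by rewrite maddC madd0. Qed.

(** * Correspondence between steps of expressions and firings of the net *)

Lemma lts_fires R al R' : lts def R al R' -> fires def (dec R) al (dec R').
Proof.
elim=> {R al R'} [al P|I P j al P' _|P Q al P' _|P Q al Q' _|P Q a P' Q' _
  |P a al P' _|P f al P' _|A al P' _].
- exists (dec (Prefix al P)), (dec P), (@mzero _); rewrite !madd0.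
  by split=> //; apply: TrPrefix.
- move=> [H [J [L [tr eP eP']]]].
  exists (dec (Sum P)), (dec P'), (@mzero _); rewrite !madd0; split=> //.
  by rewrite eP'; apply: (@TrSum _ _ _ _ _ _ j); rewrite eP ?maddK //;
    apply: mle_addr.
- move=> [H [J [L [tr eP eP']]]].
  exists (mparL H), (mparL J), (madd (mparL L) (mparR (dec Q))).
  split; first exact: TrParL.
    by rewrite (dec_ParD eP (esym (madd0l _))) mparR0 madd0.
  by rewrite (dec_ParD eP' (esym (madd0l _))) mparR0 madd0.
- move=> [H [J [L [tr eQ eQ']]]].
  exists (mparR H), (mparR J), (madd (mparL (dec P)) (mparR L)).
  split; first exact: TrParR.
    by rewrite (dec_ParD (esym (madd0l _)) eQ) mparL0 madd0l.
  by rewrite (dec_ParD (esym (madd0l _)) eQ') mparL0 madd0l.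
- move=> [H [J [L [trP eP eP']]]] _ [H2 [J2 [L2 [trQ eQ eQ']]]].
  exists (madd (mparL H) (mparR H2)), (madd (mparL J) (mparR J2)).
  exists (madd (mparL L) (mparR L2)); split; first exact: TrComm trP trQ.
    exact: dec_ParD.
  exact: dec_ParD.
- move=> [H [J [L [tr eP eP']]]] neq neq'.
  exists (mrestr a H), (mrestr a J), (mrestr a L); split; first exact: TrRestr.
    by rewrite decRestr eP /mrestr (mimageD (@GRestr_inj a)).
  by rewrite decRestr eP' /mrestr (mimageD (@GRestr_inj a)).
- move=> [H [J [L [tr eP eP']]]].
  exists (mrelab f H), (mrelab f J), (mrelab f L); split; first exact: TrRelab.
    by rewrite decRelab eP /mrelab (mimageD (@GRelab_inj f)).
  by rewrite decRelab eP' /mrelab (mimageD (@GRelab_inj f)).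
- move=> [H [J [L [tr eP eP']]]].
  exists (dec (Ident A)), (dec P'), (@mzero _); rewrite !madd0; split=> //.
  by rewrite eP'; apply: TrIdent; rewrite eP ?maddK //; apply: mle_addr.
Qed.

Lemma trans_lts H al J R L : trans def H al J -> dec R = madd H L ->
  exists R', lts def R al R' /\ dec R' = madd J L.
Proof.
move=> tr; elim: tr R L => {H al J}.
- move=> al P R L eR.
  have RE : R = Prefix al P.
    exact: dec_set_GPrefix (dec_madd_set eR (mset_of1_self _)).
  (* The preset is all of [dec R], so [L] is empty. *)
  move: eR; rewrite RE => /madd_eql ->.
  by exists P; rewrite madd0; split=> //; apply: LtsPrefix.
- move=> I P j K' al J leK _ IH R L eR.
  have RE : R = Sum P by exact: dec_set_GSum (dec_madd_set eR (mset_of1_self _)).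
  move: eR; rewrite RE => /madd_eql ->; rewrite madd0.
  (* Since [K'] lies below [dec (P j)], adding it back to the preset of the premise gives
     [dec (P j)]; the resulting marking [madd J K'] is the postset of the conclusion. *)
  have [P' [ltsP eP']] := IH (P j) K' (esym (msubK leK)).
  by exists P'; split=> //; apply: LtsSum ltsP.
- move=> H al J tr IH R L eR.
  have [mu Hmu] := trans_preset_gt0 tr.
  have [|P [Q RE]] := @dec_set_GParL R mu.
    by apply: dec_madd_set eR _; rewrite /mparL (mimage_inj GParL_inj).
  (* An empty right preset is added to match the splitting lemma; then [L2] is all of [dec Q]. *)
  move: eR; rewrite RE -{1}[mparL H]madd0 -mparR0.
  move=> /mpar_eq_madd[L1 [L2 [eP eQ ->]]].
  have [P' [ltsP eP']] := IH _ _ eP.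
  exists (Par P' Q); split; first exact: LtsParL.
  by rewrite (dec_ParD eP' eQ) mparR0 madd0.
- move=> H al J tr IH R L eR.
  have [mu Hmu] := trans_preset_gt0 tr.
  have [|P [Q RE]] := @dec_set_GParR R mu.
    by apply: dec_madd_set eR _; rewrite /mparR (mimage_inj GParR_inj).
  move: eR; rewrite RE -{1}[mparR H]madd0l -mparL0.
  move=> /mpar_eq_madd[L1 [L2 [eP eQ ->]]].
  have [Q' [ltsQ eQ']] := IH _ _ eQ.
  exists (Par P Q'); split; first exact: LtsParR.
  by rewrite (dec_ParD eP eQ') mparL0 madd0l.
- move=> H a J H2 J2 tr IH _ IH2 R L eR.
  have [mu Hmu] := trans_preset_gt0 tr.
  (* A grape from the left partner alone already forces a parallel composition. *)
  have [|P [Q RE]] := @dec_set_GParL R mu.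
    apply: dec_madd_set eR _.
    by rewrite /madd ltn_addr // /mparL (mimage_inj GParL_inj).
  move: eR; rewrite RE => /mpar_eq_madd[L1 [L2 [eP eQ ->]]].
  have [P' [ltsP eP']] := IH _ _ eP.
  have [Q' [ltsQ eQ']] := IH2 _ _ eQ.
  exists (Par P' Q'); split; first exact: LtsComm ltsP ltsQ.
  exact: dec_ParD.
- move=> H al J a tr IH neq neq' R L eR.
  have [mu Hmu] := trans_preset_gt0 tr.
  have [|P RE] := @dec_set_GRestr R mu a.
    by apply: dec_madd_set eR _; rewrite /mrestr (mimage_inj (@GRestr_inj a)).
  move: eR; rewrite RE decRestr.
  (* The idle tokens of [R] also carry the restriction, so they come from a residue [L'] of [P]. *)
  move=> /(mimage_eq_madd (@GRestr_inj a))[L' eP ->].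
  have [P' [ltsP eP']] := IH _ _ eP.
  exists (Restr P' a); split; first exact: LtsRestr.
  by rewrite decRestr eP' /mrestr (mimageD (@GRestr_inj a)).
- move=> H al J f tr IH R L eR.
  have [mu Hmu] := trans_preset_gt0 tr.
  have [|P RE] := @dec_set_GRelab R mu f.
    by apply: dec_madd_set eR _; rewrite /mrelab (mimage_inj (@GRelab_inj f)).
  move: eR; rewrite RE decRelab.
  move=> /(mimage_eq_madd (@GRelab_inj f))[L' eP ->].
  have [P' [ltsP eP']] := IH _ _ eP.
  exists (Relab P' f); split; first exact: LtsRelab.
  by rewrite decRelab eP' /mrelab (mimageD (@GRelab_inj f)).
- move=> A K' al J leK _ IH R L eR.
  have RE : R = Ident A.
    exact: dec_set_GIdent (dec_madd_set eR (mset_of1_self _)).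
  move: eR; rewrite RE => /madd_eql ->; rewrite madd0.
  have [P' [ltsP eP']] := IH (def A) K' (esym (msubK leK)).
  by exists P'; split=> //; apply: LtsIdent.
Qed.

End CCS.

Theorem theorem4 (N K O : Type) (def : K -> ccs N K O)
    (R : ccs N K O) (al : action N O) :
  (forall R' : ccs N K O, lts def R al R' -> fires def (dec R) al (dec R')) /\
  (forall M : multiset (grape N K O), fires def (dec R) al M ->
     exists R' : ccs N K O, lts def R al R' /\ dec R' = M).
Proof.
split=> [R' | M [H [J [L [tr eR ->]]]]]; first exact: lts_fires.
exact: trans_lts tr eR.
Qed.
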